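(* For every integer $r\ge1$, $$v_r^-\le\operatorname{vol}K\le v_r^+ .$$
   Context: Setting: $n,m\ge1$ are integers, $w=(w_1,\dots,w_n)$ is a vector of positive integers and $|w|:=\sum_i w_i$. $g:\mathbb{R}^n\to[0,\infty)$ is a polynomial with $g(t^{w_1}x_1,\dots,t^{w_n}x_n)=t^m g(x)$ for all $t>0$, $x\in\mathbb{R}^n$, and $g(x)>0$ for $x\ne0$. Let $B:=[-1,1]^n$ and $K:=\{x\in\mathbb{R}^n: g(x)\le1\}$; it is assumed that $K\subseteq B$. Let $\bar g:=\max_{x\in B}g(x)$; it is assumed that $\bar g>1$. $\operatorname{vol}$ is Lebesgue measure. Let $\mu$ be the uniform probability measure on $B$ and $\nu:=g_\#\mu$ its pushforward under $g$, a probability measure on $[0,\bar g]$. Let $\nu_w$ be the probability measure on $[0,1]$ with density $\frac{|w|}{m}t^{|w|/m-1}$. For a finite signed measure $\sigma$ on $\mathbb{R}$ with compact support, $M_r(\sigma)$ is the $(r+1)\times(r+1)$ matrix with entries $\int t^{i+j}d\sigma(t)$, $0\le i,j\le r$; for a polynomial $h$, $M_{r-1}(h\sigma)$ is the $r\times r$ matrix with entries $\int h(t)t^{i+j}d\sigma(t)$, $0\le i,j\le r-1$. Let $h(t):=(t-1)(\bar g-t)$. For symmetric $A$ and symmetric positive definite $C$ of the same size, $\lambda_{\min}(A,C)$ is the smallest real $\lambda$ with $\det(A-\lambda C)=0$. The matrices $M_r(\nu_w)$ and $-M_{r-1}(h\nu_w)$ are positive definite, and $$v_r^+:=2^n\lambda_{\min}\bigl(M_r(\nu),M_r(\nu_w)\bigr),\qquad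 v_r^-:=-2^n\lambda_{\min}\bigl(M_{r-1}(h\nu),-M_{r-1}(h\nu_w)\bigr).$$ *)

(* Defs.v *)
(* [mpoly] is loaded but not imported: its notations are incompatible with those
   of MathComp-Analysis. *)
From HB Require Import structures.
From mathcomp Require Import all_boot all_order all_algebra.
From mathcomp Require Import all_classical all_reals all_analysis.
From mathcomp Require Import measurable_realfun.
From mathcomp Require mpoly.

Set Implicit Arguments.
Unset Strict Implicit.
Unset Printing Implicit Defensive.

Import Order.TTheory GRing.Theory Num.Theory.
Import numFieldNormedType.Exports.

Local Open Scope classical_set_scope.
Local Open Scope ring_scope.

Notation euclid R n := (n.-tuple (measurableTypeR R)).

Section lebesgue_tuple.
Context {R : realType}.

Definition tcons n (p : measurableTypeR R * euclid R n) : euclid R n.+1 :=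
  [tuple of p.1 :: p.2].

Lemma measurable_tcons n : measurable_fun [set: _] (@tcons n).
Proof. exact: measurable_cons. Qed.

(* A product measure rather than an outer measure: it is determined on the
   Borel sets of R^n only, which include all the sets considered here. *)
Fixpoint lebesgue_tuple n : set (euclid R n) -> \bar R :=
  match n with
  | 0 => dirac ([tuple] : euclid R 0)
  | n'.+1 => pushforward (product_measure1 lebesgue_measure
                            (@lebesgue_tuple n')) (@tcons n')
  end.

Section step.
Context n (mu : {sigma_finite_measure set (euclid R n) -> \bar R}).
Local Notation leb := (@lebesgue_measure R).

Let step : set (euclid R n.+1) -> \bar R :=
  pushforward (product_measure1 leb mu) (@tcons n).

Let step0 : step set0 = 0%E.
Proof. by rewrite /step /pushforward preimage_set0 measure0. Qed.

Let step_ge0 A : (0 <= step A)%E.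
Proof. by rewrite /step /pushforward measure_ge0. Qed.

Let step_additive : semi_sigma_additive step.
Proof.
exact: (@measure_semi_sigma_additive _ _ _
  (measure_function_pushforward__canonical__measure_function_Measure
     (product_measure1 leb mu) (@measurable_tcons n))).
Qed.

HB.instance Definition _ := isMeasure.Build _ _ _ step
  step0 step_ge0 step_additive.

Let step_sigma_finite : sigma_finite setT step.
Proof.
have [F UF FP] : sigma_finite setT (product_measure1 leb mu).
  have /sigma_finiteP[F [TF ndF Foo]] := sigma_finiteT leb.
  have /sigma_finiteP[G [TG ndG Goo]] := sigma_finiteT mu.
  exists (fun k => F k `*` G k).
    rewrite -setXTT TF TG predeqE => -[x y]; split.
      move=> [/= [i _ Fix] [j _ Gjy]]; exists (maxn i j) => //; split.
      - by move: x Fix; exact/subsetPset/ndF/leq_maxl.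
      - by move: y Gjy; exact/subsetPset/ndG/leq_maxr.
    by move=> [i _ []/= ? ?]; split; exists i.
  move=> k; have [? ?] := Foo k; have [? ?] := Goo k.
  split; first exact: measurableX.
  by rewrite product_measure1E// lte_mul_pinfty// ge0_fin_numE.
pose u (t : euclid R n.+1) : measurableTypeR R * euclid R n :=
  (tnth t ord0, [tuple of behead t]).
have tconsK p : u (tcons p) = p.
  by case: p => x t; congr pair => //; apply: val_inj.
have mu_ : measurable_fun setT u.
  apply: measurable_fun_pair; first exact: measurable_tnth.
  exact: measurable_behead.
exists (fun k => u @^-1` F k).
  by rewrite -preimage_bigcup -UF preimage_setT.
move=> k; have [mF Foo] := FP k; split.
  by rewrite -[X in measurable X]setTI; exact: mu_.
rewrite /step /pushforward -comp_preimage (_ : u \o _ = id)//.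
by apply/funext => p; exact: tconsK.
Qed.

HB.instance Definition _ := Measure_isSigmaFinite.Build _ _ _ step
  step_sigma_finite.

Lemma lebesgue_tuple_step :
  exists nu : {sigma_finite_measure set (euclid R n.+1) -> \bar R},
    pushforward (product_measure1 leb mu) (@tcons n) = nu.
Proof. by exists step. Qed.

End step.

Lemma lebesgue_tuple_measure n :
  exists mu : {sigma_finite_measure set (euclid R n) -> \bar R},
    @lebesgue_tuple n = mu.
Proof.
elim: n => [|n [mu /= ->]]; last exact: lebesgue_tuple_step.
by exists (dirac ([tuple] : euclid R 0)).
Qed.

Section instances.
Variable n : nat.

Let leb0 : @lebesgue_tuple n set0 = 0%E.
Proof. by have [mu ->] := lebesgue_tuple_measure n; exact: measure0. Qed.

Let leb_ge0 A : (0 <= @lebesgue_tuple n A)%E.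
Proof. by have [mu ->] := lebesgue_tuple_measure n; exact: measure_ge0. Qed.

Let leb_additive : semi_sigma_additive (@lebesgue_tuple n).
Proof.
have [mu ->] := lebesgue_tuple_measure n.
exact: measure_semi_sigma_additive.
Qed.

HB.instance Definition _ := isMeasure.Build _ _ _ (@lebesgue_tuple n)
  leb0 leb_ge0 leb_additive.

Let leb_sigma_finite : sigma_finite setT (@lebesgue_tuple n).
Proof. by have [mu ->] := lebesgue_tuple_measure n; exact: sigma_finiteT. Qed.

HB.instance Definition _ := Measure_isSigmaFinite.Build _ _ _
  (@lebesgue_tuple n) leb_sigma_finite.

End instances.

Lemma measurable_box n (A : 'I_n -> set (measurableTypeR R)) :
  (forall i, measurable (A i)) ->
  measurable [set x : euclid R n | forall i, A i (tnth x i)].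
Proof.
move=> mA; rewrite (_ : [set _ | _] =
    \bigcap_(i in [set: 'I_n]) ((@tnth n _ ^~ i) @^-1` A i)).
  apply: fin_bigcap_measurable => // i _.
  by rewrite -[X in measurable X]setTI; exact: measurable_tnth.
by apply/seteqP; split => x /= h i => [_|]; exact: h.
Qed.

Lemma lebesgue_tuple_box n (A : 'I_n -> set (measurableTypeR R)) :
  (forall i, measurable (A i)) ->
  lebesgue_tuple [set x : euclid R n | forall i, A i (tnth x i)] =
  (\prod_(i < n) lebesgue_measure (A i))%E.
Proof.
elim: n A => [|n IH] A mA.
  by rewrite big_ord0 /= diracE mem_set// => -[].
rewrite big_ord_recl -IH//= /pushforward.
rewrite -product_measure1E//; last exact: (measurable_box (A := fun i => A (lift ord0 i))).
congr product_measure1; apply/seteqP; split => -[x t] /=.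
  move=> h; split; first exact: (h ord0).
  by move=> i; have := h (lift ord0 i); rewrite tnthS.
move=> [h0 h] i; case: (unliftP ord0 i) => [j ->|->//].
by rewrite tnthS.
Qed.

Lemma lebesgue_tuple_cube n :
  lebesgue_tuple [set x : euclid R n | forall i, -1 <= tnth x i <= 1] =
  (2 ^+ n)%:E.
Proof.
rewrite (_ : [set _ | _] =
    [set x : euclid R n | forall i, `[-1, 1]%classic (tnth x i)]); last first.
  by apply/seteqP; split => x /= h i; have := h i; rewrite in_itv.
rewrite (lebesgue_tuple_box (A := fun=> `[-1, 1]%classic))//=.
rewrite lebesgue_measure_itv/= lte_fin gtrN//.
by rewrite -EFinB opprK prodEFin prodr_const card_ord.
Qed.

End lebesgue_tuple.

Section setting.
Context {R : realType} (n : nat).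

Definition cube : set (euclid R n) :=
  [set x | forall i, -1 <= tnth x i <= 1].

Lemma measurable_cube : measurable cube.
Proof.
rewrite (_ : cube =
    [set x | forall i, `[-1, 1]%classic (tnth x i)]); last first.
  by apply/seteqP; split => x /= h i; have := h i; rewrite /= in_itv.
exact: (measurable_box (A := fun=> `[-1, 1]%classic)).
Qed.

Definition uniform_cube : set (euclid R n) -> \bar R :=
  mscale ((2 ^+ n)^-1)%:nng (mrestr (@lebesgue_tuple R n) measurable_cube).

HB.instance Definition _ := Measure.on uniform_cube.

Let uniform_cubeT : uniform_cube [set: _] = 1%E.
Proof.
rewrite /uniform_cube /mscale /= /mrestr setTI lebesgue_tuple_cube.
by rewrite -EFinM mulVf// expf_neq0.
Qed.

HB.instance Definition _ := @Measure_isProbability.Build _ _ R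
  uniform_cube uniform_cubeT.

Implicit Types (g : mpoly.mpoly n R) (w : 'I_n -> nat) (m r : nat).

Definition peval g (x : euclid R n) : measurableTypeR R :=
  mpoly.meval (tnth x) g.

Lemma measurable_peval g : measurable_fun [set: _] (peval g).
Proof.
rewrite /peval; under eq_fun do rewrite mpoly.mevalE.
apply: measurable_sum => k; apply: measurable_funM => //.
apply: measurable_prod => i _; apply: measurable_funX.
exact: measurable_tnth.
Qed.

Definition image_prob g : set (measurableTypeR R) -> \bar R :=
  pushforward uniform_cube (peval g).

Section image_prob.
Variable g : mpoly.mpoly n R.

Let image0 : image_prob g set0 = 0%E.
Proof. by rewrite /image_prob /pushforward preimage_set0 measure0. Qed.

Let image_ge0 A : (0 <= image_prob g A)%E.
Proof. by rewrite /image_prob /pushforward measure_ge0. Qed.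

Let image_additive : semi_sigma_additive (image_prob g).
Proof.
exact: (@measure_semi_sigma_additive _ _ _
  (measure_function_pushforward__canonical__measure_function_Measure
     uniform_cube (measurable_peval g))).
Qed.

HB.instance Definition _ := isMeasure.Build _ _ _ (image_prob g)
  image0 image_ge0 image_additive.

Let imageT : image_prob g [set: _] = 1%E.
Proof. by rewrite /image_prob /pushforward preimage_setT probability_setT. Qed.

HB.instance Definition _ := @Measure_isProbability.Build _ _ R
  (image_prob g) imageT.

End image_prob.

(* The value at t = 0, where the exponent a - 1 may be negative, is irrelevant:
   {0} is a null set. *)
Definition weight_density w m (t : R) : R :=
  let a := (\sum_(i < n) w i)%:R / m%:R in a * t `^ (a - 1).

Definition weight_prob w m : set (measurableTypeR R) -> \bar R := fun A =>
  (\int[lebesgue_measure]_(t in A `&` `[0%R, 1%R]) (weight_density w m t)%:E)%E.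

Section weight_prob.
Variables (w : 'I_n -> nat) (m : nat).

Let density_ge0 t : 0 <= weight_density w m t.
Proof. by rewrite mulr_ge0 ?powR_ge0. Qed.

Let measurable_density : measurable_fun [set: _] (weight_density w m).
Proof. by apply: measurable_funM => //; exact: measurable_powR. Qed.

Let weight0 : weight_prob w m set0 = 0%E.
Proof. by rewrite /weight_prob set0I integral_set0. Qed.

Let weight_ge0 A : (0 <= weight_prob w m A)%E.
Proof. by apply: integral_ge0 => t _; rewrite lee_fin density_ge0. Qed.

Let weight_additive : semi_sigma_additive (weight_prob w m).
Proof.
move=> /= F mF tF mUF; rewrite /weight_prob; apply: cvg_toP.
  apply: ereal_nondecreasing_is_cvgn => i j ij.
  apply: lee_sum_nneg_natr => // k _ _.
  exact: weight_ge0.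
rewrite setI_bigcupl ge0_integral_bigcup//=.
- by move=> i; exact: measurableI.
- apply: measurable_funTS; apply: measurableT_comp => //.
- by move=> x _; rewrite lee_fin density_ge0.
- exact: trivIset_setIr.
Qed.

HB.instance Definition _ := isMeasure.Build _ _ _ (weight_prob w m)
  weight0 weight_ge0 weight_additive.

End weight_prob.

Definition sublevel g : set (euclid R n) := [set x | peval g x <= 1].

End setting.

Arguments cube {R} n.
Arguments uniform_cube {R} n.

Section moments.
Context {R : realType}.
Implicit Types (S : set R) (sigma : {measure set (measurableTypeR R) -> \bar R}).

(* These denote the minimum and maximum of S only when S has one. *)
Definition set_min S : R := xget 0 (S `&` lbound S).
Definition set_max S : R := xget 0 (S `&` ubound S).

Definition lambda_min k (A C : 'M[R]_k) : R :=
  set_min [set l | \det (A - l *: C) = 0].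

Definition moment_mx r sigma : 'M[R]_r.+1 :=
  \matrix_(i, j) \int[sigma]_t (t ^+ (i + j)).

(* [localizing_mx h r sigma] is the moment matrix of order r of the signed
   measure of density h with respect to sigma. *)
Definition localizing_mx (h : R -> R) r sigma : 'M[R]_r.+1 :=
  \matrix_(i, j) \int[sigma]_t (h t * t ^+ (i + j)).

End moments.

Section bounds.
Context {R : realType} (n m : nat) (w : 'I_n -> nat) (g : mpoly.mpoly n R).

Definition gbar : R := set_max (peval g @` cube n).

Definition hpoly (t : R) : R := (t - 1) * (gbar - t).

Definition upper_bound r : R :=
  2 ^+ n * lambda_min (moment_mx r (image_prob g))
                      (moment_mx r (weight_prob w m)).

Definition lower_bound r : R :=
  - (2 ^+ n * lambda_min (localizing_mx hpoly r.-1 (image_prob g))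
                         (- localizing_mx hpoly r.-1 (weight_prob w m))).

End bounds.

(* Main.v *)
Require Import Defs.
From HB Require Import structures.
From mathcomp Require Import all_boot all_order all_algebra.
From mathcomp Require Import all_classical all_reals all_analysis.
From mathcomp Require Import measurable_realfun ring lra.
From mathcomp Require mpoly.

Set Implicit Arguments.
Unset Strict Implicit.
Unset Printing Implicit Defensive.

Import Order.TTheory GRing.Theory Num.Theory.
Import numFieldNormedType.Exports.

Local Open Scope classical_set_scope.
Local Open Scope ring_scope.

(* Write a = |w|/m and c = vol K / 2^n.  Weighted homogeneity and K <= B give
   vol {g <= t} = t^a vol K on [0, 1], hence nu restricted to [0, 1] is c nu_w.
   If p has degree at most r, then v^T M_r(nu) v is the integral of p^2 against
   nu; dropping the part of nu on ]1, gbar], it is at least c v^T M_r(nu_w) v,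
   so that c bounds every generalized eigenvalue from below.  With the factor
   h, which is nonnegative on [1, gbar], the same argument shows that - c
   bounds the generalized eigenvalues of the second pencil.  In both cases the
   least generalized eigenvalue exists: it is the minimum of the Rayleigh
   quotient. *)

(** * Lebesgue measure under coordinatewise dilations *)

Section dilation.
Context {R : realType}.

(** By uniqueness of Lebesgue measure it is enough to compare the two sides on half-open intervals,
    whose preimages are half-open intervals rescaled by [c^-1]. *)
Lemma lebesgue_measure_dilation (c : R) (A : set (measurableTypeR R)) :
    0 < c -> measurable A ->
  (c%:E * lebesgue_measure ( *%R c @^-1` A))%E = lebesgue_measure A.
Proof.
move=> c0 mA; have mM : measurable_fun [set: measurableTypeR R]
    ( *%R c : measurableTypeR R -> measurableTypeR R).
  exact: mulrl_measurable.
pose mu := mscale (NngNum (ltW c0))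
  (measure_function_pushforward__canonical__measure_function_Measure
     (@lebesgue_measure R) mM).
rewrite -[LHS]/(mu A); apply/esym; apply: (@lebesgue_measure_unique R mu) => //.
move=> _ [[a b] _ <-] /=.
rewrite /mscale/= /pushforward.
rewrite (_ : _ @^-1` _ = `](c^-1 * a), (c^-1 * b)]%classic); last first.
  apply/seteqP; split => x /=; rewrite !in_itv/=;
  by rewrite ltr_pdivrMl// ler_pdivlMl.
rewrite !lebesgue_measure_itv/= !lte_fin ltr_pM2l ?invr_gt0//.
by case: ifP => _; rewrite ?mule0// -!EFinB -EFinM -mulrBr mulVKf ?gt_eqF.
Qed.

Definition dilation n (c : 'I_n -> R) (x : euclid R n) : euclid R n :=
  [tuple c i * tnth x i | i < n].

Lemma measurable_dilation n (c : 'I_n -> R) :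
  measurable_fun [set: euclid R n] (dilation c).
Proof.
apply/measurable_fun_tnthP => i.
rewrite (_ : _ \o _ = fun x => c i * tnth x i); last first.
  by apply/funext => x /=; rewrite tnth_mktuple.
by apply: measurable_funM => //; exact: measurable_tnth.
Qed.

(** Induction on the dimension: through [tcons] the dilation becomes the product [D] of a dilation
    of the line and one of the tail, and a measure with the right values on measurable rectangles is
    the product measure. *)
Lemma lebesgue_tuple_dilation n (c : 'I_n -> R) (A : set (euclid R n)) :
    (forall i, 0 < c i) -> measurable A ->
  ((\prod_(i < n) c i)%:E * lebesgue_tuple (dilation c @^-1` A))%E =
  lebesgue_tuple A.
Proof.
elim: n c A => [|n IH] c A c0 mA.
  rewrite big_ord0 mul1e; congr (lebesgue_tuple _).
  by apply/seteqP; split => x /=; rewrite (tuple0 (dilation c x)) (tuple0 x).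
pose c' i := c (lift ord0 i).
pose D (p : measurableTypeR R * euclid R n) : measurableTypeR R * euclid R n :=
  (c ord0 * p.1, dilation c' p.2).
have mD : measurable_fun setT D.
  apply: measurable_fun_pair; first exact: measurable_funM.
  exact: measurableT_comp (measurable_dilation c') measurable_snd.
have p0 : 0 <= \prod_(i < n.+1) c i by rewrite prodr_ge0// => i _; exact: ltW.
pose mu := mscale (NngNum p0)
  (measure_function_pushforward__canonical__measure_function_Measure
     (product_measure1 (@lebesgue_measure R) (@lebesgue_tuple R n)) mD).
rewrite /= /pushforward.
have dilation_tcons (p : measurableTypeR R * euclid R n) :
    dilation c (tcons p) = tcons (D p).
  apply: eq_from_tnth => i; rewrite tnth_mktuple.
  by case: (unliftP ord0 i) => [j ->|->//]; rewrite !tnthS tnth_mktuple.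
rewrite (_ : @tcons R n @^-1` (dilation c @^-1` A) =
    D @^-1` (@tcons R n @^-1` A));
  last by apply/seteqP; split => p; rewrite /preimage/= dilation_tcons.
rewrite -[LHS]/(mu (@tcons R n @^-1` A)); apply/esym.
apply: (@product_measure_unique _ _ _ _ _ _ _ mu).
  move=> /= B C mB mC; rewrite /mu /mscale/= /pushforward big_ord_recl EFinM.
  rewrite (_ : _ @^-1` _ =
    ( *%R (c ord0) @^-1` B) `*` (dilation c' @^-1` C)) //.
  rewrite product_measure1E//.
  - by rewrite muleACA lebesgue_measure_dilation// IH// => i; exact: c0.
  - rewrite -[X in measurable X]setTI; exact: mulrl_measurable.
  - rewrite -[X in measurable X]setTI; exact: measurable_dilation.
rewrite -[X in measurable X]setTI; exact: measurable_tcons.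
Qed.

End dilation.

(** * Distribution functions on the line and the integral of a power *)

Section measure_on_the_line.
Context {R : realType}.
Implicit Types (x : R) (m : {measure set (measurableTypeR R) -> \bar R}).

(** Half-open intervals are differences of two rays, and they form a generating class stable under
    intersection. Finiteness makes the subtraction of masses legitimate. *)
Lemma measure_unique_Nyc m1 m2 : (m1 setT < +oo)%E ->
    (forall x, m1 `]-oo, x]%classic = m2 `]-oo, x]%classic) ->
  forall A, measurable A -> m1 A = m2 A.
Proof.
move=> m1oo m12 A mA.
have m1lt B : measurable B -> (m1 B < +oo)%E.
  by move=> mB; rewrite (le_lt_trans _ m1oo)// le_measure// inE.
have := @measure_unique _ R (measurableTypeR R) (@ocitv R)
  (fun k => `](- k%:R), k%:R]%classic) _ _ _ _ m1 m2.
apply => //; last by move=> k; apply: m1lt.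
- exact: ocitvI.
- by move=> k; apply: is_ocitv.
- rewrite -subTset => x _; exists (Num.truncn `|x|).+1 => //=.
  have /andP[] : - (Num.truncn `|x|).+1%:R < x < (Num.truncn `|x|).+1%:R.
    by rewrite -ltr_norml truncnS_gt.
  by rewrite in_itv/= => -> /ltW.
- move=> _ [[a b] _ <-] /=.
  have [ab|ba] := leP a b; last first.
    by rewrite set_itv_ge ?measure0// bnd_simp -leNgt ltW.
  have abE : `]a, b]%classic = `]-oo, b]%classic `\` `]-oo, a]%classic.
    apply/seteqP; split => x /=; rewrite !in_itv/=.
      by move=> /andP[ax ->]; split => //; apply/negP; rewrite -ltNge.
    by move=> [-> /negP]; rewrite -ltNge => ->.
  have sub : `]-oo, b]%classic `&` `]-oo, a]%classic = `]-oo, a]%classic.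
    by rewrite setIidr// => x /=; rewrite !in_itv/= => /le_trans; exact.
  have m2lt : (m2 `]-oo, b]%classic < +oo)%E by rewrite -m12 m1lt.
  rewrite abE !measureD// ?sub; last exact: m1lt.
  by congr (_ - _)%E; exact: m12.
Qed.

(** For [a < 1] the integrand is unbounded near 0, so the fundamental theorem of calculus is applied
    on segments away from 0, followed by monotone convergence. *)
Lemma integral_powR (a x : R) : 0 < a -> 0 <= x ->
  (\int[lebesgue_measure]_(t in `[0%R, x]) (a * t `^ (a - 1))%:E =
   (x `^ a)%:E)%E.
Proof.
move=> a0; rewrite le_eqVlt => /predU1P[<-|x0].
  by rewrite set_itv1 integral_set1 powR0 ?gt_eqF.
(* Left endpoints decreasing to 0. The segments below start at [e k.+1], because [e 0] is [x] itself
   and the fundamental theorem needs a nondegenerate segment. *)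
pose e k : R := x * k.+1%:R^-1.
have e0 k : 0 < e k by rewrite mulr_gt0.
have ex k : e k <= x by rewrite /e ler_piMr ?(ltW x0)// invf_le1// ler1n.
have eS k : e k.+1 < e k by rewrite /e ltr_pM2l// ltf_pV2 ?posrE// ltr_nat.
have df (b y : R) : 0 < y -> {for y, continuous (fun t : R => t `^ b)}.
  move=> y0; apply/differentiable_continuous/derivable1_diffP.
  by apply: derivable_powR; rewrite in_itv/= y0.
have mf (D : set (measurableTypeR R)) :
    measurable_fun D (fun t => (a * t `^ (a - 1))%:E).
  apply: measurable_funTS; apply: measurableT_comp => //.
  by apply: measurable_funM => //; exact: measurable_powR.
have int_e k :
  (\int[lebesgue_measure]_(t in `[e k.+1, x]) (a * t `^ (a - 1))%:E =
   (x `^ a)%:E - (e k.+1 `^ a)%:E)%E.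
  have ex' : e k.+1 < x by rewrite (lt_le_trans (eS k)).
  apply: (@continuous_FTC2 _ (fun t => a * t `^ (a - 1))
    (fun t => t `^ a)) => //.
  - apply: continuous_in_subspaceT => y; rewrite inE/= in_itv/= => /andP[ey _].
    apply: cvgM; first exact: cvg_cst.
    by apply: df; rewrite (lt_le_trans _ ey).
  - split.
    + move=> y; rewrite in_itv/= => /andP[ey _].
      by apply: derivable_powR; rewrite in_itv/= andbT (lt_trans _ ey).
    + by apply: cvg_at_right_filter; exact: df.
    + by apply: cvg_at_left_filter; exact: df.
  - move=> y; rewrite in_itv/= => /andP[ey _].
    by apply: powR_derive1; rewrite in_itv/= andbT (lt_trans _ ey).
have eU : \bigcup_k `[e k.+1, x]%classic = `]0, x]%classic.
  apply/seteqP; split => t.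
    move=> [k _] /=; rewrite !in_itv/= => /andP[et ->].
    by rewrite (lt_le_trans _ et).
  rewrite /= in_itv/= => /andP[t0 tx].
  have xt0 : 0 <= x / t by rewrite divr_ge0 ?ltW.
  exists (Num.truncn (x / t)) => //=; rewrite in_itv/= tx andbT.
  rewrite /e ler_pdivrMr// -ler_pdivrMl// mulrC.
  by rewrite (le_trans (ltW (truncnS_gt _)))// ler_nat.
rewrite -integral_itv_obnd_cbnd; last first.
  exact: mf.
rewrite -eU.
have H := @ge0_nondecreasing_set_cvg_integral _ (measurableTypeR R) _
  (fun k => `[e k.+1, x]%classic) (fun t => (a * t `^ (a - 1))%:E)
  (@lebesgue_measure R).
apply: cvg_unique (H _ _ _ _) _ => //.
- apply/nondecreasing_seqP => k; rewrite subsetEset => t /=.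
  by rewrite !in_itv/= => /andP[et ->]; rewrite (le_trans (ltW (eS _)) et).
- by move=> k t _; rewrite lee_fin mulr_ge0 ?powR_ge0 ?ltW.
rewrite /=; under eq_fun do rewrite int_e -EFinB.
apply: cvg_EFin; first by near=> k.
rewrite -[X in _ --> X]subr0; apply: cvgB; first exact: cvg_cst.
(* Since [a > 0], the power tends to 0 at 0 from the right, in particular along the endpoints. *)
have /cvg_at_rightP := powR_cvg0 a0; apply; split; first by [].
rewrite -(mulr0 x); apply: cvgM; first exact: cvg_cst.
by have := @cvg_harmonic R; rewrite -cvg_shiftS.
Unshelve. all: by end_near. Qed.
End measure_on_the_line.

(** * The volume of sublevel sets, and the image measure on [0, 1] *)

Section image_and_weight.
Context {R : realType} (n m : nat) (w : 'I_n -> nat) (g : mpoly.mpoly n R).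
Hypotheses (n_gt0 : (0 < n)%N) (m_gt0 : (0 < m)%N).
Hypothesis w_gt0 : forall i, (0 < w i)%N.
Hypothesis g_ge0 : forall x : euclid R n, 0 <= peval g x.
Hypothesis g_homogeneous : forall (t : R) (x : euclid R n), 0 < t ->
  peval g [tuple t ^+ w i * tnth x i | i < n] = t ^+ m * peval g x.
Hypothesis g_gt0 :
  forall x : euclid R n, x <> [tuple 0 | i < n] -> 0 < peval g x.
Hypothesis sublevel_cube : sublevel g `<=` cube n.

Let a : R := (\sum_(i < n) w i)%:R / m%:R.

Let a_gt0 : 0 < a.
Proof.
rewrite divr_gt0 ?ltr0n// (bigD1 (Ordinal n_gt0))//=.
by rewrite (leq_trans (w_gt0 (Ordinal n_gt0)))// leq_addr.
Qed.

Lemma weight_prob_Nyc (x : R) : weight_prob w m `]-oo, x]%classic =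
  (if 0 <= x then Num.min x 1 `^ a else 0)%:E.
Proof.
rewrite /weight_prob; case: leP => [x0|x0]; last first.
  rewrite (_ : _ `&` _ = set0) ?integral_set0//; apply/seteqP; split => t //=.
  rewrite !in_itv/= => -[tx /andP[t0 _]]; have := le_trans t0 tx.
  by rewrite leNgt x0.
rewrite -integral_powR ?le_min ?x0 ?ler01//; congr (integral _ _ _).
by apply/seteqP; split => t /=; rewrite !in_itv/= le_min;
  [move=> [-> /andP[-> ->]]|move=> /andP[-> /andP[-> ->]]].
Qed.

Lemma measurable_peval_le (x : R) : measurable [set y | peval g y <= x].
Proof.
rewrite (_ : [set y | _] = peval g @^-1` `]-oo, x]%classic).
  rewrite -[X in measurable X]setTI; exact: measurable_peval.
by apply/seteqP; split => y; rewrite /= in_itv.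
Qed.

(** For x > 0 put s = x^(1/m): by weighted homogeneity the dilation with factors s^(w_i) carries K
    onto {g <= x}, and its Jacobian is s^|w| = x^a. For x = 0 the set lies in {0}, since g > 0
    elsewhere. *)
Lemma lebesgue_tuple_peval_le (x : R) : 0 <= x ->
  lebesgue_tuple [set y | peval g y <= x] =
  ((x `^ a)%:E * lebesgue_tuple (sublevel g))%E.
Proof.
rewrite le_eqVlt => /predU1P[<-|x0].
  rewrite powR0 ?gt_eqF// mul0e; apply/eqP.
  rewrite -measure_le0.
  (* The origin seen as a box; since n > 0 it has a side of length zero. *)
  pose B := [set y : euclid R n | forall i, [set (0 : R)] (tnth y i)].
  have mB : measurable B by apply: (measurable_box (A := fun=> [set (0 : R)])).
  have -> : 0%E = lebesgue_tuple B.
    rewrite (lebesgue_tuple_box (A := fun=> [set (0 : R)]))//.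
    by rewrite (bigD1 (Ordinal n_gt0))//= lebesgue_measure_set1 mul0e.
  apply: le_measure; rewrite ?inE//; first exact: measurable_peval_le.
  move=> y /= gy i; have [->|/g_gt0] := pselect (y = [tuple 0 | i < n]).
    by rewrite tnth_mktuple.
  by rewrite ltNge gy.
pose s := x `^ m%:R^-1; have s0 : 0 < s by exact: powR_gt0.
have sm : s ^+ m = x.
  by rewrite -powR_mulrn ?ltW// -powRrM mulVf ?pnatr_eq0 -?lt0n// powRr1 ?ltW.
have -> : x `^ a = \prod_(i < n) s ^+ w i.
  by rewrite prodrXr -powR_mulrn ?ltW// -powRrM mulrC.
rewrite -(lebesgue_tuple_dilation (c := fun i => s ^+ w i)); last 2 first.
- by move=> i; exact: exprn_gt0.
- exact: measurable_peval_le.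
congr (_ * lebesgue_tuple _)%E; apply/seteqP; split => y;
by rewrite /sublevel /preimage /= /dilation g_homogeneous// sm ger_pMr.
Qed.

Definition volume_ratio : R := fine (lebesgue_tuple (sublevel g)) / 2 ^+ n.

(** K lies in the cube, so its volume is finite and [fine] in [volume_ratio] loses nothing. *)
Lemma lebesgue_tuple_sublevel :
  lebesgue_tuple (sublevel g) = (2 ^+ n * volume_ratio)%:E.
Proof.
rewrite /volume_ratio mulrC divfK ?expf_neq0// fineK// ge0_fin_numE//.
apply: (@le_lt_trans _ _ (lebesgue_tuple (@cube R n))).
  apply: le_measure; rewrite ?inE//.
    exact: measurable_peval_le.
  exact: measurable_cube.
by rewrite lebesgue_tuple_cube ltry.
Qed.

Lemma volume_ratio_ge0 : 0 <= volume_ratio.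
Proof. by rewrite divr_ge0 ?fine_ge0// exprn_ge0. Qed.

(** Both sides are measures in [A], so their distribution functions are compared: each is c min(x,
    1)^a for x >= 0 and 0 for x < 0. *)
Lemma image_prob_weight (A : set (measurableTypeR R)) : measurable A ->
  image_prob g (A `&` `[0, 1]%classic) =
  (volume_ratio%:E * weight_prob w m A)%E.
Proof.
move=> mA.
have mI : measurable (`[0, 1]%classic : set (measurableTypeR R)) by [].
pose m1 := mrestr (image_prob g) mI.
pose m2 := mscale (NngNum volume_ratio_ge0) (weight_prob w m).
rewrite -[LHS]/(m1 A) -[RHS]/(m2 A); apply: measure_unique_Nyc => // [|x].
  apply: le_lt_trans (ltry 1); apply: probability_le1.
  exact: measurableI.
rewrite -[LHS]/(((2 ^+ n)^-1)%:E * lebesgue_tuple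
    (peval g @^-1` (`]-oo, x]%classic `&` `[0%R, 1%R]%classic) `&` cube n))%E.
rewrite -[RHS]/(volume_ratio%:E * weight_prob w m `]-oo, x]%classic)%E.
rewrite weight_prob_Nyc.
case: leP => [x0|x0]; last first.
  rewrite mule0 (_ : _ `&` _ = set0) ?measure0 ?mule0//.
  apply/seteqP; split => y //=.
  rewrite !in_itv/= => -[[yx /andP[y0 _]] _]; have := le_trans y0 yx.
  by rewrite leNgt x0.
rewrite (_ : _ `&` _ = [set y | peval g y <= Num.min x 1]).
  rewrite lebesgue_tuple_peval_le ?le_min ?x0 ?ler01//.
  rewrite lebesgue_tuple_sublevel -!EFinM; congr EFin.
  by rewrite mulrCA mulKf ?expf_neq0// mulrC.
(* A point with g <= 1 lies in the cube by assumption, so the restriction to the cube is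
   harmless. *)
apply/seteqP; split => y /=; rewrite !in_itv/= le_min.
  by move=> [[-> /andP[_ ->]]].
by move=> /andP[-> g1]; rewrite g_ge0 g1; split => //; exact: sublevel_cube.
Qed.

End image_and_weight.

(** * Quadratic forms and the least generalized eigenvalue *)

Section pencil.
Context {R : realType}.

Definition qform k (A : 'M[R]_k) (v : 'rV[R]_k) : R := (v *m A *m v^T) 0 0.

Lemma qformZ k (A : 'M[R]_k) (s : R) (v : 'rV[R]_k) :
  qform A (s *: v) = s ^+ 2 * qform A v.
Proof.
by rewrite /qform linearZ/= -scalemxAl -scalemxAl -scalemxAr scalerA mxE expr2.
Qed.

Lemma qformE k (A : 'M[R]_k) (v : 'rV[R]_k) :
  qform A v = \sum_i \sum_j v 0 i * v 0 j * A i j.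
Proof.
rewrite /qform mxE exchange_big/=; apply: eq_bigr => j _.
rewrite !mxE mulr_suml; apply: eq_bigr => i _; exact: mulrAC.
Qed.

Lemma continuous_qform k (A : 'M[R]_k) : continuous (qform A).
Proof.
rewrite (_ : qform A = fun v => \sum_i \sum_j v 0 i * v 0 j * A i j);
  last first.
  by apply/funext => v; exact: qformE.
have sumc (F : 'I_k -> 'rV[R]_k -> R) :
    (forall i, continuous (F i)) -> continuous (fun v => \sum_i F i v).
  move=> cF; apply: (continuous_big _ (op := +%R)) => // v.
  by apply: cvgD; [exact: cvg_fst|exact: cvg_snd].
have cc i : continuous (fun v : 'rV[R]_k => v 0 i) by exact: coord_continuous.
apply: (sumc _) => i; apply: (sumc _) => j v.
exact: (cvgM (cvgM (cc i v) (cc j v)) (cvg_cst _)).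
Qed.

(** Turns a minimiser of the Rayleigh quotient into a kernel vector of the pencil, hence into a root
    of the determinant. *)
Lemma psd_qform_eq0 k (Q : 'M[R]_k) (v : 'rV[R]_k) : Q^T = Q ->
  (forall u, 0 <= qform Q u) -> qform Q v = 0 -> v *m Q = 0.
Proof.
move=> sQ Q0 Qv.
suff b0 (u : 'rV[R]_k) : (v *m Q *m u^T) 0 0 = 0.
  apply/rowP => j; rewrite [RHS]mxE -[RHS](b0 (delta_mx 0 j)).
  by rewrite trmx_delta -colE [RHS]mxE.
set b := (_ *m _) 0 0; pose d := qform Q u.
have d0 : 0 <= d := Q0 u.
pose s := (d + 1)^-1; have s0 : 0 < s by rewrite invr_gt0; lra.
have sd : s * d = 1 - s.
  have d1 : d + 1 != 0 by rewrite gt_eqF//; lra.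
  by rewrite /s; field.
(* the nonnegative quadratic t |-> qform Q (v + t u) = 2 b t + d t^2 is
   negative at t = - b / (d + 1) unless b = 0 *)
have := Q0 (v + (- b * s) *: u).
have -> : qform Q (v + (- b * s) *: u) = - 2 * b ^+ 2 * s + (b * s) ^+ 2 * d.
  have bT : (u *m Q *m v^T) 0 0 = b.
    rewrite /b -[in RHS](trmxK (v *m Q *m u^T)) [RHS]mxE.
    by rewrite !trmx_mul trmxK sQ mulmxA.
  rewrite {1}/qform linearD linearZ/= mulmxDl !mulmxDr mulmxDl.
  have entryD (X Y : 'M[R]_1) : (X + Y) 0 0 = X 0 0 + Y 0 0 by rewrite mxE.
  have entryZ s' (X : 'M[R]_1) : (s' *: X) 0 0 = s' * X 0 0 by rewrite mxE.
  rewrite mulmxDl -!scalemxAl -!scalemxAr !(entryD, entryZ).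
  rewrite -[(v *m Q *m v^T) 0 0]/(qform Q v) Qv bT -/b -[(u *m Q *m u^T) 0 0]/d.
  by ring.
rewrite (_ : _ + _ = - (b ^+ 2 * (s + s ^+ 2))); last first.
  rewrite (_ : (b * s) ^+ 2 * d = b ^+ 2 * s * (s * d)); last by ring.
  by rewrite sd; ring.
rewrite oppr_ge0 pmulr_lle0; last by rewrite addr_gt0// exprn_gt0.
by move=> b2; apply/eqP; rewrite -sqrf_eq0 eq_le b2 sqr_ge0.
Qed.

(** The Rayleigh quotient attains its minimum [l0] on the compact unit sphere. Then A - l0 C is
    positive semidefinite and its form vanishes at the minimiser, so [l0] is a generalized
    eigenvalue. A kernel vector [v] for any eigenvalue [l] satisfies [qform A v = l * qform C v],
    which gives both l0 <= l and c <= l. *)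
Lemma lambda_min_ge k (A C : 'M[R]_k.+1) (c : R) : A^T = A -> C^T = C ->
    (forall v, v != 0 -> 0 < qform C v) ->
    (forall v, c * qform C v <= qform A v) ->
  c <= lambda_min A C.
Proof.
move=> sA sC C0 cA.
have qB l v : qform (A - l *: C) v = qform A v - l * qform C v.
  by rewrite /qform mulmxBr mulmxBl -scalemxAr -scalemxAl !mxE.
pose S := [set v : 'rV[R]_k.+1 | `|v| = 1].
have Sn0 v : S v -> v != 0.
  apply: contraPneq => ->; rewrite /S/= normr0 => /eqP.
  by rewrite eq_sym oner_eq0.
have scale v : v != 0 -> S (`|v|^-1 *: v).
  by move=> v0; rewrite /S/= normrZ normfV normr_id mulVf// normr_eq0.
have Sne : S !=set0.
  pose v1 : 'rV[R]_k.+1 := const_mx 1.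
  exists (`|v1|^-1 *: v1); apply: scale.
  by apply/eqP => /rowP/(_ 0); rewrite !mxE => /eqP; rewrite oner_eq0.
have cS : compact S.
  apply: bounded_closed_compact.
    by exists 1; split => // M M1 v; rewrite /S/= => ->; exact: ltW.
  apply: (@closed_comp _ _ (fun v : 'rV[R]_k.+1 => `|v|) [set 1]).
    by move=> v _; exact: norm_continuous.
  exact: closed_eq.
have cf : {within S, continuous (fun v => qform A v / qform C v)}.
  apply: continuous_in_subspaceT => v /set_mem/Sn0 v0.
  have Cv : qform C v != 0 by rewrite gt_eqF// C0.
  exact: (cvgM (@continuous_qform _ A v) (cvgV Cv (@continuous_qform _ C v))).
have [v0 /set_mem Sv0 minv] := EVT_min_rV Sne cS cf.
have v00 := Sn0 _ Sv0; have Cv0 := C0 _ v00.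
pose l0 := qform A v0 / qform C v0.
(* From the sphere to all vectors: both forms scale by the same square, which cancels in the
   quotient. *)
have lA v : l0 * qform C v <= qform A v.
  have [->|vn0] := eqVneq v 0.
    by rewrite -(scale0r (0 : 'rV_k.+1)) !qformZ expr0n !mul0r mulr0.
  have := minv _ (mem_set (scale _ vn0)).
  rewrite !qformZ -mulf_div divff ?mul1r; first by rewrite ler_pdivlMr// C0.
  by rewrite expf_neq0// invr_neq0// normr_eq0.
pose E := [set l | \det (A - l *: C) = 0].
have l0P : (E `&` lbound E) l0.
  split => /=.
    apply/eqP/det0P; exists v0 => //; apply: psd_qform_eq0.
    - by rewrite linearB linearZ/= sA sC.
    - by move=> u; rewrite qB subr_ge0.
    - by rewrite qB /l0 divfK ?subrr// gt_eqF.
  move=> l /= /eqP/det0P[v vn0 vl].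
  have : qform (A - l *: C) v = 0 by rewrite /qform vl mul0mx mxE.
  rewrite qB => /subr0_eq Al; have := lA v.
  by rewrite Al ler_pM2r// C0.
(* [xget] falls back to 0 when there is no minimum; [l0P] excludes this case. *)
rewrite /lambda_min /set_min; case: xgetP => [l _ [+ _]|/(_ l0)]; last by [].
move=> /= /eqP/det0P[v vn0 vl].
have : qform (A - l *: C) v = 0 by rewrite /qform vl mul0mx mxE.
rewrite qB => /subr0_eq Al; have := cA v.
by rewrite Al ler_pM2r// C0.
Qed.

End pencil.

(** * Integrals of polynomials and localizing matrices *)

Section polynomial_integrals.
Context {R : realType}.
Implicit Types q : {poly R}.
Implicit Types sigma : {measure set (measurableTypeR R) -> \bar R}.

Lemma measurable_horner q (D : set (measurableTypeR R)) :
  measurable_fun D (horner q : measurableTypeR R -> measurableTypeR R).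
Proof.
apply: measurable_funTS; apply: continuous_measurable_fun.
exact: continuous_horner.
Qed.

(** A polynomial is bounded on the compact interval [0, b], which carries all the mass of the finite
    measure. *)
Lemma integrable_horner sigma (b : R) q : (sigma setT < +oo)%E ->
    sigma (~` `[0%R, b]%classic) = 0%E ->
  sigma.-integrable setT (fun t => (q.[t])%:E).
Proof.
move=> fin0 sup0.
have mI : measurable (`[0%R, b]%classic : set (measurableTypeR R)) by [].
have mq D : measurable_fun D (fun t : measurableTypeR R => (q.[t])%:E).
  by apply: measurableT_comp => //; exact: measurable_horner.
have mC := measurableC mI; rewrite (negligible_integrable mC)//.
rewrite setTD setCK; apply: measurable_bounded_integrable => //.
- by rewrite (le_lt_trans _ fin0)// le_measure// inE.
- exact: measurable_horner.
- have : bounded_set (horner q @` `[0%R, b]%classic).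
    apply/compact_bounded/continuous_compact; last exact: segment_compact.
    by apply: continuous_subspaceT; exact: continuous_horner.
  move=> [M [Mreal HM]]; exists M; split => // y My x xb.
  by apply: HM => //; exists x.
Qed.

Lemma Rintegral_sum_horner sigma (b : R) (I : Type) (s : seq I)
    (q : I -> {poly R}) :
    (sigma setT < +oo)%E -> sigma (~` `[0%R, b]%classic) = 0%E ->
  \int[sigma]_t (\sum_(i <- s) q i).[t] = \sum_(i <- s) \int[sigma]_t (q i).[t].
Proof.
move=> fin0 sup0; elim: s => [|i s IH].
  rewrite !big_nil; under eq_Rintegral do rewrite horner0.
  by rewrite Rintegral_cst// mul0r.
rewrite !big_cons -IH -RintegralD//; last 2 first.
- exact: integrable_horner sup0.
- exact: integrable_horner sup0.
by apply: eq_Rintegral => t _; rewrite hornerD.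
Qed.

(** The vector is read as the coefficients of a polynomial p of degree at most [r], and expanding h
    p^2 gives the double sum of the form. Matrix inequalities thus become inequalities between
    integrals. *)
Lemma qform_localizing sigma (b : R) (h : {poly R}) r (v : 'rV[R]_r.+1) :
    (sigma setT < +oo)%E -> sigma (~` `[0%R, b]%classic) = 0%E ->
  qform (localizing_mx (horner h) r sigma) v =
  \int[sigma]_t (h * rVpoly v ^+ 2).[t].
Proof.
move=> fin0 sup0; rewrite qformE.
have -> : h * rVpoly v ^+ 2 =
    \sum_i \sum_j (v 0 i * v 0 j) *: (h * 'X^(i + j)).
  have -> : rVpoly v = \sum_i v 0 i *: 'X^i.
    rewrite /rVpoly poly_def; apply: eq_bigr => i _.
    by rewrite insubT//= => ?; congr (v 0 _ *: _); exact: val_inj.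
  rewrite expr2 mulr_suml mulr_sumr; apply: eq_bigr => i _.
  rewrite mulr_sumr mulr_sumr; apply: eq_bigr => j _.
  by rewrite -scalerAl -!scalerAr scalerA exprD.
rewrite (Rintegral_sum_horner _ _ fin0 sup0); apply: eq_bigr => i _.
rewrite (Rintegral_sum_horner _ _ fin0 sup0); apply: eq_bigr => j _.
rewrite mxE -RintegralZl//; last first.
  rewrite [X in _.-integrable _ X](_ : _ = fun t => ((h * 'X^(i + j)).[t])%:E).
    exact: integrable_horner sup0.
  by apply/funext => t /=; rewrite hornerM hornerXn.
by apply: eq_Rintegral => t _; rewrite hornerZ hornerM hornerXn.
Qed.

Lemma finite_root q : q != 0 -> finite_set [set t | q.[t] = 0].
Proof.
move=> q0; apply: contrapT => /(@infinite_set_fset _ _ (size q))[X Xq].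
apply/negP; rewrite -ltnNge; apply: max_poly_roots => //.
  by apply/allP => t /Xq /= qt; apply/eqP.
exact: finmap.fset_uniq.
Qed.

Lemma trmx_localizing h r sigma :
  (localizing_mx h r sigma)^T = localizing_mx h r sigma.
Proof. by apply/matrixP => i j; rewrite !mxE addnC. Qed.

(** Lets a single argument, for a general localizing polynomial, treat both pencils. *)
Lemma moment_localizing r sigma :
  moment_mx r sigma = localizing_mx (horner (1 : {poly R})) r sigma.
Proof.
apply/matrixP => i j; rewrite !mxE; apply: eq_Rintegral => t _.
by rewrite hornerC mul1r.
Qed.

End polynomial_integrals.

(** * Comparison and positivity of integrals *)

Section domination.
Context {R : realType}.
Implicit Types sigma tau : {measure set (measurableTypeR R) -> \bar R}.

(** As [f] may change sign, its positive and negative parts are scaled separately; integrability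
    keeps their difference finite. *)
Lemma Rintegral_mscale sigma (k : {nonneg R}) (D : set (measurableTypeR R))
    (f : measurableTypeR R -> R) :
    measurable D -> sigma.-integrable D (EFin \o f) ->
  \int[mscale k sigma]_(t in D) f t = k%:num * \int[sigma]_(t in D) f t.
Proof.
move=> mD intf; have mf := measurable_int _ intf.
have intp := integrable_funepos mD intf.
have intn := integrable_funeneg mD intf.
rewrite /Rintegral integralE [in RHS]integralE.
rewrite !ge0_integral_mscale//; last 2 first.
- exact: measurable_int intn.
- exact: measurable_int intp.
have fp := integrable_fin_num mD intp; have fn := integrable_fin_num mD intn.
by rewrite -muleBr ?fin_num_adde_defr// fineM// fin_numB fp fn.
Qed.

(** On [0, 1] the measure [sigma] is [c] times [tau], so the two contributions agree whatever the
    sign of [q] there. The rest of the mass of [sigma] sits in ]1, b], where [q] is nonnegative. *)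
Lemma Rintegral_dominated (q : {poly R}) (b c : R) sigma tau :
    (sigma setT < +oo)%E -> (tau setT < +oo)%E ->
    sigma (~` `[0%R, b]%classic) = 0%E -> tau (~` `[0%R, 1%R]%classic) = 0%E ->
    0 <= c ->
    (forall A : set (measurableTypeR R), measurable A ->
      sigma (A `&` `[0%R, 1%R]%classic) = (c%:E * tau A)%E) ->
    (forall t, 1 < t <= b -> 0 <= q.[t]) ->
  c * \int[tau]_t q.[t] <= \int[sigma]_t q.[t].
Proof.
move=> sfin tfin ssup tsup c0 scale q0.
have mI : measurable (`[0%R, 1%R]%classic : set (measurableTypeR R)) by [].
have mJ : measurable (`[0%R, b]%classic : set (measurableTypeR R)) by [].
have ints := integrable_horner q sfin ssup.
have intt := integrable_horner q tfin tsup.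
have intsS D : measurable D -> sigma.-integrable D (fun t => (q.[t])%:E).
  by move=> mD; exact: integrableS ints.
have -> : \int[tau]_t q.[t] = \int[tau]_(t in `[0%R, 1%R]) q.[t].
  rewrite /Rintegral (negligible_integral (measurableC mI))//.
  by rewrite setTD setCK.
have -> : \int[sigma]_t q.[t] =
    \int[sigma]_(t in `[0%R, 1%R]) q.[t] +
    \int[sigma]_(t in ~` `[0%R, 1%R]) q.[t].
  rewrite -Rintegral_setU//.
  - by rewrite setUv.
  - exact: measurableC.
  - by rewrite setUv.
  - by rewrite disj_set2E setICr.
have -> : \int[sigma]_(t in `[0%R, 1%R]) q.[t] =
    c * \int[tau]_(t in `[0%R, 1%R]) q.[t].
  rewrite -(Rintegral_mscale (NngNum c0))//; last exact: integrableS intt.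
  rewrite /Rintegral; congr fine; apply: eq_measure_integral => A mA AI.
  by rewrite -[RHS]/(c%:E * tau A)%E -scale// setIidl.
rewrite lerDl /Rintegral (negligible_integral (measurableC mJ))//; last 2 first.
- exact: measurableC.
- by apply: intsS; exact: measurableC.
apply: fine_ge0; apply: integral_ge0 => t /=; rewrite !in_itv/=.
move=> [/negP tI /contrapT /andP[t0 tb]]; rewrite lee_fin q0// tb andbT ltNge.
by apply: contra tI => ->; rewrite t0.
Qed.

(** If the integral were zero, [q] would vanish almost everywhere on [0, 1]. Its roots are finitely
    many, hence null, so the line would be covered by three null sets, against [tau setT > 0]. *)
Lemma Rintegral_horner_gt0 (q : {poly R}) tau : (tau setT < +oo)%E ->
    (0 < tau setT)%E -> tau (~` `[0%R, 1%R]%classic) = 0%E ->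
    (forall F : set (measurableTypeR R), finite_set F -> tau F = 0%E) ->
    q != 0 -> (forall t, 0 <= t <= 1 -> 0 <= q.[t]) ->
  0 < \int[tau]_t q.[t].
Proof.
move=> tfin tpos tsup tF q0 qge0.
have mI : measurable (`[0%R, 1%R]%classic : set (measurableTypeR R)) by [].
have intt := integrable_horner q tfin tsup.
have intI : tau.-integrable `[0%R, 1%R]%classic (fun t => (q.[t])%:E).
  exact: integrableS intt.
have -> : \int[tau]_t q.[t] = \int[tau]_(t in `[0%R, 1%R]) q.[t].
  rewrite /Rintegral (negligible_integral (measurableC mI))//.
  by rewrite setTD setCK.
have qI t : `[0%R, 1%R]%classic t -> 0 <= q.[t].
  by rewrite /= in_itv/=; exact: qge0.
rewrite lt_neqAle Rintegral_ge0// andbT; apply/eqP => /esym int0.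
have : (\int[tau]_(t in `[0%R, 1%R]) `|(q.[t])%:E| = 0)%E.
  under eq_integral => t /set_mem tI do rewrite gee0_abs ?lee_fin ?qI//.
  rewrite -[LHS]fineK ?integrable_fin_num//.
  by rewrite -[X in X%:E]/(Rintegral _ _ _) int0.
move/(ae_eq_integral_abs tau mI (measurable_int _ intI)) => [N [mN N0 NI]].
pose Z := [set t | q.[t] = 0].
have fZ : finite_set Z := finite_root q0.
have mZ : measurable (Z : set (measurableTypeR R)).
  exact: countable_measurable (finite_set_countable fZ).
have : (tau setT <= tau (Z `|` N `|` ~` `[0%R, 1%R]%classic))%E.
  apply: le_measure; rewrite ?inE//.
    by apply: measurableU; [exact: measurableU|exact: measurableC].
  move=> t _; have [tI|tI] := pselect (`[0%R, 1%R]%classic t); last by right.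
  left; have [|qt] := pselect (Z t); first by left.
  by right; apply: NI => /= /(_ tI) [].
apply/negP; rewrite -ltNge (le_lt_trans _ tpos)//.
have mC := measurableC mI; have mZN := measurableU _ _ mZ mN.
apply: (le_trans (measureU2 tau mZN mC)); rewrite [X in (_ + X)%E]tsup adde0.
apply: (le_trans (measureU2 tau mZ mN)).
by rewrite [X in (_ + X)%E]N0 adde0 [X in (X <= _)%E]tF.
Qed.

End domination.

(** * Support, null sets and total mass of nu_w *)

Section weight_prob_properties.
Context {R : realType} (n m : nat) (w : 'I_n -> nat).
Local Notation nu_w := (@weight_prob R n w m).

Lemma weight_probC : nu_w (~` `[0%R, 1%R]%classic) = 0%E.
Proof. by rewrite /weight_prob setICl integral_set0. Qed.

Lemma weight_prob_finite (F : set (measurableTypeR R)) :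
  finite_set F -> nu_w F = 0%E.
Proof.
move=> fF.
have cF := finite_set_countable (finite_setIl `[0%R, 1%R]%classic fF).
have mF := countable_measurable (@measurable_set1 R) cF.
rewrite /weight_prob null_set_integral//;
  last exact: countable_lebesgue_measure0.
apply: measurable_funTS; apply: measurableT_comp => //.
by apply: measurable_funM => //; exact: measurable_powR.
Qed.

Lemma weight_probT : (0 < n)%N -> (0 < m)%N -> (forall i, (0 < w i)%N) ->
  nu_w setT = 1%E.
Proof.
move=> n0 m0 w0; have := @weight_prob_Nyc R n m w n0 m0 w0 1.
rewrite ler01 minxx powR1 => <-; rewrite /weight_prob; congr (integral _ _ _).
rewrite setTI setIidr// => t /=; rewrite !in_itv/= => /andP[_ ->] //.
Qed.

End weight_prob_properties.

(** * The two eigenvalue bounds *)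

Section bounds.
Context {R : realType} (n m : nat) (w : 'I_n -> nat) (g : mpoly.mpoly n R).
Hypotheses (n_gt0 : (0 < n)%N) (m_gt0 : (0 < m)%N).
Hypothesis w_gt0 : forall i, (0 < w i)%N.
Hypothesis g_ge0 : forall x : euclid R n, 0 <= peval g x.
Hypothesis g_homogeneous : forall (t : R) (x : euclid R n), 0 < t ->
  peval g [tuple t ^+ w i * tnth x i | i < n] = t ^+ m * peval g x.
Hypothesis g_gt0 :
  forall x : euclid R n, x <> [tuple 0 | i < n] -> 0 < peval g x.
Hypothesis sublevel_cube : sublevel g `<=` cube n.
Hypothesis gbar_gt1 : 1 < gbar g.

(** [gbar] would be the default 0 if g had no maximum on the cube; [gbar_gt1] rules this out, so
    [gbar] is a genuine maximum. *)
Lemma peval_le_gbar x : cube n x -> peval g x <= gbar g.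
Proof.
move: gbar_gt1; rewrite /gbar /set_max; case: xgetP => [y _ [_ ub] _ cx|_].
  by apply: ub; exists x.
by rewrite ltr10.
Qed.

Lemma image_probC : image_prob g (~` `[0%R, gbar g]%classic) = 0%E.
Proof.
rewrite -[LHS]/(((2 ^+ n)^-1)%:E * lebesgue_tuple
    (peval g @^-1` (~` `[0%R, gbar g]%classic) `&` cube n))%E.
rewrite (_ : _ `&` _ = set0) ?measure0 ?mule0//; apply/seteqP; split => x //=.
by case=> nI cx; apply: nI; rewrite in_itv/=; apply/andP; split;
  [exact: g_ge0|exact: peval_le_gbar].
Qed.

Let image_fin : (image_prob g setT < +oo)%E.
Proof. by rewrite probability_setT ltry. Qed.

Let weightT : weight_prob w m [set: measurableTypeR R] = 1%E.
Proof. exact: weight_probT. Qed.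

Let weight_fin : (weight_prob w m [set: measurableTypeR R] < +oo)%E.
Proof. by rewrite weightT ltry. Qed.

(* Both bounds at once: s = 1 and h = 1 for the upper one, s = - 1 and h = hpoly
   for the lower one. *)
Lemma volume_ratio_le_lambda_min (s : R) (h : {poly R}) r :
    h != 0 -> s ^+ 2 = 1 ->
    (forall t, 0 <= t <= 1 -> 0 <= s * h.[t]) ->
    (forall t, 1 < t <= gbar g -> 0 <= h.[t]) ->
  s * volume_ratio g <= lambda_min (localizing_mx (horner h) r (image_prob g))
      (s *: localizing_mx (horner h) r (weight_prob w m)).
Proof.
move=> h0 s2 hI hJ.
have qs := qform_localizing h _ image_fin image_probC.
have qw := qform_localizing h _ weight_fin (weight_probC m w).
have qsZ (v : 'rV[R]_r.+1) (A : 'M[R]_r.+1) : qform (s *: A) v = s * qform A v.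
  by rewrite /qform -scalemxAr -scalemxAl mxE.
apply: lambda_min_ge.
- exact: trmx_localizing.
- by rewrite linearZ/= trmx_localizing.
- move=> v v0; rewrite qsZ qw -RintegralZl//; last first.
    exact: integrable_horner weight_fin (weight_probC m w).
  have -> : \int[weight_prob w m]_t (s * (h * rVpoly v ^+ 2).[t]) =
      \int[weight_prob w m]_t (s *: (h * rVpoly v ^+ 2)).[t].
    by apply: eq_Rintegral => t _; rewrite hornerZ.
  apply: Rintegral_horner_gt0 => //.
  - by rewrite [X in (_ < X)%E]weightT lte01.
  - exact: weight_probC.
  - exact: weight_prob_finite.
  (* [s] is nonzero because its square is 1, and a nonzero vector gives a nonzero polynomial. *)
  - rewrite scaler_eq0 negb_or mulf_neq0 ?expf_neq0//.
      by rewrite -sqrf_eq0 s2 oner_eq0.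
    by apply: contra_neq v0 => pv0; rewrite -[v]rVpolyK pv0 linear0.
  - move=> t tI; rewrite hornerZ hornerM mulrA mulr_ge0 ?hI//.
    by rewrite horner_exp sqr_ge0.
(* The two factors [s] cancel, leaving the comparison of integrals of h p^2 with constant c. *)
- move=> v; rewrite qsZ mulrACA -expr2 s2 mul1r qs qw.
  apply: (@Rintegral_dominated _ _ (gbar g)) => //.
  - exact: image_probC.
  - exact: weight_probC.
  - exact: volume_ratio_ge0.
  - move=> A mA; exact: (image_prob_weight n_gt0).
  - move=> t tJ; rewrite hornerM mulr_ge0 ?hJ//.
    by rewrite horner_exp sqr_ge0.
Qed.

End bounds.

Theorem proposition4 (R : realType) (n m : nat) (w : 'I_n -> nat)
    (g : mpoly.mpoly n R)
    (n_gt0 : (0 < n)%N) (m_gt0 : (0 < m)%N) (w_gt0 : forall i, (0 < w i)%N)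
    (g_ge0 : forall x : euclid R n, 0 <= peval g x)
    (g_homogeneous : forall (t : R) (x : euclid R n), 0 < t ->
      peval g [tuple t ^+ w i * tnth x i | i < n] = t ^+ m * peval g x)
    (g_gt0 : forall x : euclid R n, x <> [tuple 0 | i < n] -> 0 < peval g x)
    (sublevel_cube : sublevel g `<=` cube n)
    (gbar_gt1 : 1 < gbar g)
    (r : nat) (r_gt0 : (0 < r)%N) :
  ((lower_bound m w g r)%:E <= lebesgue_tuple (sublevel g)
     <= (upper_bound m w g r)%:E)%E.
Proof.
have p2 : 0 < 2 ^+ n :> R by exact: exprn_gt0.
rewrite lebesgue_tuple_sublevel// !lee_fin /lower_bound /upper_bound.
(* After division by 2^n, both claims are lower bounds on a least eigenvalue: by - c for the
   localizing pencil and by c for the moment pencil. *)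
rewrite lerNl -mulrN !ler_pM2l//; apply/andP; split.
- pose h : {poly R} := ('X - 1%:P) * ((gbar g)%:P - 'X).
  have hE : horner h = hpoly g.
    by apply/funext => t; rewrite /h /hpoly !hornerE.
  (* The index [r.-1] gives matrices of size r, that is, test polynomials of degree at most r -
     1. *)
  have := @volume_ratio_le_lambda_min R n m w g n_gt0 m_gt0 w_gt0 g_ge0
    g_homogeneous g_gt0 sublevel_cube gbar_gt1 (-1) h r.-1.
  rewrite mulN1r scaleN1r hE; apply.
  + rewrite mulf_neq0 ?polyXsubC_eq0// -opprB oppr_eq0 polyXsubC_eq0//.
  + by rewrite sqrrN expr1n.
  (* On [0, 1] the factor t - 1 is nonpositive and gbar - t is positive, so - h >= 0; this sign
     makes the negated localizing matrix of nu_w positive definite. *)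
  + move=> t /andP[t0 t1]; rewrite /hpoly mulN1r -mulNr opprB.
    by rewrite mulr_ge0//; lra.
  + by move=> t /andP[t0 t1]; rewrite /hpoly mulr_ge0//; lra.
- have := @volume_ratio_le_lambda_min R n m w g n_gt0 m_gt0 w_gt0 g_ge0
    g_homogeneous g_gt0 sublevel_cube gbar_gt1 1 1 r.
  rewrite mul1r scale1r !moment_localizing; apply.
  + exact: oner_neq0.
  + exact: expr1n.
  + by move=> t _; rewrite hornerC mulr1.
  + by move=> t _; rewrite hornerC.
Qed.
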